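(* Let $\mathbf{A}\in\mathbb{C}^{n\times n}$, let $\sigma_i\in\mathbb{C}$ be a shift such that $\mathbf{A}+\sigma_i\mathbf{I}$ is invertible, and let $\mathbf{R}\in\mathbb{C}^{n\times s}$. Let $\mathcal{K}_j(\mathbf{A},\mathbf{R})$ be the associated block Krylov subspace, with matrices $\mathbf{W}_j\in\mathbb{C}^{n\times js}$, $\mathbf{W}_{j+1}\in\mathbb{C}^{n\times (j+1)s}$ and $\overline{\mathbf{H}}_j\in\mathbb{C}^{(j+1)s\times js}$ generated by the block Arnoldi process, run without breakdown. Let $\mathcal{U}\subset\mathbb{C}^n$ be a $k$-dimensional subspace spanned by the columns of $\mathbf{U}\in\mathbb{C}^{n\times k}$, and let $\mathbf{C}=\mathbf{A}\mathbf{U}$. Define $$\widehat{\mathbf{V}}_j=\begin{bmatrix}\mathbf{U} & \mathbf{W}_j\end{bmatrix}\in\mathbb{C}^{n\times(k+js)},\qquad \widehat{\mathbf{W}}_{j+1}=\begin{bmatrix}\mathbf{C} & \mathbf{W}_{j+1}\end{bmatrix}\in\mathbb{C}^{n\times(k+(j+1)s)},$$ $$\overline{\mathbf{G}}_j^{(i)}=\begin{bmatrix}\mathbf{I} & 0\\ 0 & \sigma_i\overline{\mathbf{I}}+\overline{\mathbf{H}}_j\end{bmatrix}\in\mathbb{C}^{(k+(j+1)s)\times(k+js)},\qquad \mathbf{M}^{(i)}=\begin{bmatrix}\sigma_i\mathbf{U} & 0\end{bmatrix}\in\mathbb{C}^{n\times(k+js)}.$$ Then the harmonic Ritz problem for the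 matrix $\mathbf{A}+\sigma_i\mathbf{I}$ with respect to the augmented block Krylov subspace $\mathcal{K}_j(\mathbf{A},\mathbf{R})+\mathcal{U}$ amounts to solving the eigenproblem $$(\widehat{\mathbf{W}}_{j+1}\overline{\mathbf{G}}_j^{(i)}+\mathbf{M}^{(i)})^{*}\,\widehat{\mathbf{V}}_j\,\mathbf{g}_\ell=\mu_\ell\,(\widehat{\mathbf{W}}_{j+1}\overline{\mathbf{G}}_j^{(i)}+\mathbf{M}^{(i)})^{*}(\widehat{\mathbf{W}}_{j+1}\overline{\mathbf{G}}_j^{(i)}+\mathbf{M}^{(i)})\,\mathbf{g}_\ell,\qquad \mu_\ell\in\mathbb{C},\ \mathbf{g}_\ell\in\mathbb{C}^{js+k}.$$ That is, a pair $(\mathbf{y}_\ell,\mu_\ell)\in\mathbb{C}^n\times\mathbb{C}$ satisfies the conditions of the harmonic Ritz problem if and only if $\mathbf{y}_\ell=(\mathbf{A}+\sigma_i\mathbf{I})\widehat{\mathbf{V}}_j\mathbf{g}_\ell$ for some $\mathbf{g}_\ell\in\mathbb{C}^{js+k}$ satisfying this equation with $\mu_\ell$.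
   Context: Block Krylov subspace: for $\mathbf{A}\in\mathbb{C}^{n\times n}$ and $\mathbf{R}\in\mathbb{C}^{n\times s}$, $\mathcal{K}_j(\mathbf{A},\mathbf{R})$ is the span of all the columns of $\mathbf{R},\mathbf{A}\mathbf{R},\dots,\mathbf{A}^{j-1}\mathbf{R}$ $(j\ge 1)$. It is assumed throughout that $\dim\mathcal{K}_j(\mathbf{A},\mathbf{R})=js$ and that there are no breakdowns in the block Arnoldi process. Block Arnoldi process: starting from the reduced QR factorization $\mathbf{R}=V_1\mathbf{S}_0$, at each step $m=1,\dots,j$ set $W=\mathbf{A}V_m$, then for $l=1,\dots,m$ set $H_{l,m}=V_l^{*}W$ and replace $W$ by $W-V_lH_{l,m}$, and finally compute the reduced QR factorization $W=V_{m+1}H_{m+1,m}$. Here $V_m\in\mathbb{C}^{n\times s}$ and $H_{l,m}\in\mathbb{C}^{s\times s}$. Set $\mathbf{W}_m=\begin{bmatrix}V_1&\cdots&V_m\end{bmatrix}$, and let $\overline{\mathbf{H}}_j\in\mathbb{C}^{(j+1)s\times js}$ be the block upper Hessenberg matrix with blocks $H_{l,m}$ (zero blocks for $l>m+1$). The columns of $\mathbf{W}_j$ form an orthonormal basis of $\mathcal{K}_j(\mathbf{A},\mathbf{R})$, the columns of $\mathbf{W}_{j+1}$ are orthonormal, and the block Arnoldi relation $\mathbf{A}\mathbf{W}_j=\mathbf{W}_{j+1}\overline{\mathbf{H}}_j$ holds. Notation: $\overline{\mathbf{I}}\in\mathbb{R}^{(j+1)s\times js}$ is the $js\times js$ identity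 matrix with $s$ rows of zeros appended underneath; $\mathbf{I}$ denotes an identity matrix of the appropriate size ($k\times k$ inside $\overline{\mathbf{G}}_j^{(i)}$); $^{*}$ is the conjugate transpose; $\perp$ refers to the standard inner product on $\mathbb{C}^n$. No orthonormality of the columns of $\mathbf{U}$ or $\mathbf{C}$ is assumed. Harmonic Ritz problem for $\mathbf{A}+\sigma_i\mathbf{I}$ with respect to the subspace $\mathcal{K}_j(\mathbf{A},\mathbf{R})+\mathcal{U}$: find pairs $(\mathbf{y}_\ell,\mu_\ell)$ with $\mathbf{y}_\ell\in(\mathbf{A}+\sigma_i\mathbf{I})(\mathcal{K}_j(\mathbf{A},\mathbf{R})+\mathcal{U})$ and $\mu_\ell\in\mathbb{C}$ such that $$(\mathbf{A}+\sigma_i\mathbf{I})^{-1}\mathbf{y}_\ell-\mu_\ell\mathbf{y}_\ell\ \perp\ (\mathbf{A}+\sigma_i\mathbf{I})(\mathcal{K}_j(\mathbf{A},\mathbf{R})+\mathcal{U}).$$ *)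

(* Defs.v *)
From mathcomp Require Import all_boot all_order all_algebra.
From mathcomp Require Import spectral sesquilinear.

Set Implicit Arguments.
Unset Strict Implicit.
Unset Printing Implicit Defensive.

Import Order.TTheory GRing.Theory Num.Theory.
Local Open Scope ring_scope.
Local Open Scope sesquilinear_scope.

Definition colspan (C : numClosedFieldType) (n m : nat) (B : 'M[C]_(n, m)) :
    {vspace 'cV[C]_n} :=
  <<[seq col c B | c <- enum 'I_m]>>%VS.

Definition block_krylov (C : numClosedFieldType) (n s : nat)
    (A : 'M[C]_n) (R : 'M[C]_(n, s)) (j : nat) : {vspace 'cV[C]_n} :=
  <<[seq col c (A ^+ i *m R) | i <- iota 0 j, c <- enum 'I_s]>>%VS.

(* [is_trig_mx] is lower triangular, whence the transpose. No sign
   normalisation of the diagonal of [T] is imposed. *)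
Definition reduced_qr (C : numClosedFieldType) (n s : nat)
    (W Q : 'M[C]_(n, s)) (T : 'M[C]_s) : Prop :=
  [/\ W = Q *m T, Q^t* *m Q = 1%:M & is_trig_mx T^T].

(* Block indices start at 0: [V m] is the block V_{m+1} and [H l m] is
   H_{l+1,m+1}. [arnoldi_residual A V H m l] is the current value of W in
   step m+1, after its first l orthogonalisation updates. *)
Fixpoint arnoldi_residual (C : numClosedFieldType) (n s : nat) (A : 'M[C]_n)
    (V : nat -> 'M[C]_(n, s)) (H : nat -> nat -> 'M[C]_s) (m l : nat) :
    'M[C]_(n, s) :=
  if l is l'.+1 then arnoldi_residual A V H m l' - V l' *m H l' m
  else A *m V m.

(* A relation rather than a function, since a reduced QR factorization is not
   unique; only [V m] for m <= j and [H l m] for m < j, l <= m+1 matter. *)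
Record block_arnoldi (C : numClosedFieldType) (n s : nat) (A : 'M[C]_n)
    (R : 'M[C]_(n, s)) (j : nat) (V : nat -> 'M[C]_(n, s))
    (S0 : 'M[C]_s) (H : nat -> nat -> 'M[C]_s) : Prop := BlockArnoldi {
  block_arnoldi_start : reduced_qr R (V 0) S0;
  block_arnoldi_orth : forall m l : nat, (m < j)%N -> (l <= m)%N ->
    H l m = (V l)^t* *m arnoldi_residual A V H m l;
  block_arnoldi_next : forall m : nat, (m < j)%N ->
    reduced_qr (arnoldi_residual A V H m m.+1) (V m.+1) (H m.+1 m)
}.

(* A breakdown at a step is a rank-deficient block handed to the QR
   factorization of that step. *)
Definition no_breakdown (C : numClosedFieldType) (n s : nat) (A : 'M[C]_n)
    (j : nat) (V : nat -> 'M[C]_(n, s)) (H : nat -> nat -> 'M[C]_s) : Prop :=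
  forall m : nat, (m < j)%N -> \rank (arnoldi_residual A V H m m.+1) = s.

(* The dimension j s appears as [\sum_(i < j) s], the size of the library's
   block matrices; the two are equal by [sum_nat_const] and [card_ord]. *)
Definition arnoldi_basis (C : numClosedFieldType) (n s : nat)
    (V : nat -> 'M[C]_(n, s)) (j : nat) : 'M[C]_(n, \sum_(i < j) s) :=
  \mxrow_(i < j) V i.

Definition arnoldi_hessenberg (C : numClosedFieldType) (s : nat)
    (H : nat -> nat -> 'M[C]_s) (j : nat) :
    'M[C]_(\sum_(l < j.+1) s, \sum_(m < j) s) :=
  \mxblock_(l < j.+1, m < j) (if (l <= m.+1)%N then H l m else 0).

Definition extended_id (C : numClosedFieldType) (s j : nat) :
    'M[C]_(\sum_(l < j.+1) s, \sum_(m < j) s) :=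
  pid_mx (\sum_(m < j) s).

(* [dotmx] acts on row vectors. *)
Definition perp (C : numClosedFieldType) (n : nat) (x : 'cV[C]_n)
    (S : {vspace 'cV[C]_n}) : Prop :=
  forall z : 'cV[C]_n, z \in S -> dotmx x^T z^T = 0.

(* As in the projection problem it expresses, [y = 0] is not excluded. *)
Definition harmonic_ritz (C : numClosedFieldType) (n : nat) (B : 'M[C]_n)
    (S : {vspace 'cV[C]_n}) (y : 'cV[C]_n) (mu : C) : Prop :=
  let BS := (linfun (mulmx B) @: S)%VS in
  y \in BS /\ perp (invmx B *m y - mu *: y) BS.

(* Main.v *)
(* The block Arnoldi relation gives [P = (A + sigma I) Vhat]. Every block
   [A^i R], [i < j], has its columns in the span of those of [W_j], which has
   dimension at most [j s]; as the Krylov space has dimension [j s], the two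
   spaces coincide. Hence [P] spans [(A + sigma I)(K_j + U)], and the
   orthogonality condition for [y = P g] becomes [P^* (Vhat g - mu P g) = 0]. *)
Require Import Defs.
From mathcomp Require Import all_boot all_order all_algebra.
From mathcomp Require Import spectral sesquilinear.
From mathcomp Require Import reals.
From mathcomp Require Import complex.

Set Implicit Arguments.
Unset Strict Implicit.
Unset Printing Implicit Defensive.

Import Order.TTheory GRing.Theory Num.Theory.
Local Open Scope ring_scope.
Local Open Scope sesquilinear_scope.

Lemma mulmx_sum_col (C : comPzRingType) n m (B : 'M[C]_(n, m)) (g : 'cV[C]_m) :
  B *m g = \sum_i g i 0 *: col i B.
Proof.
apply/colP => a; rewrite mxE summxE.
by apply: eq_bigr => i _; rewrite !mxE mulrC.
Qed.

Lemma mem_colspan_mul (C : numClosedFieldType) n m (B : 'M[C]_(n, m))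
    (g : 'cV[C]_m) : B *m g \in colspan B.
Proof.
rewrite mulmx_sum_col rpred_sum // => i _.
by rewrite rpredZ //; apply/memv_span/map_f; rewrite mem_enum.
Qed.

(** The coefficients need not be extracted from the span: the image of [linfun (mulmx B)] is a
    subspace containing every column, so it contains their span. *)
Lemma colspanP (C : numClosedFieldType) n m (B : 'M[C]_(n, m)) (y : 'cV[C]_n) :
  reflect (exists g, y = B *m g) (y \in colspan B).
Proof.
apply: (iffP idP) => [|[g ->]]; last exact: mem_colspan_mul.
suff /subvP BW : (colspan B <= limg (linfun (mulmx B : 'cV_m -> 'cV_n)))%VS.
  by move=> /BW /memv_imgP[g _ ->]; exists g; rewrite lfunE.
apply/span_subvP => _ /mapP[i _ ->]; rewrite colE.
by rewrite -[_ *m _](lfunE (mulmx B)) memv_img ?memvf.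
Qed.

Lemma dim_colspan (C : numClosedFieldType) n m (B : 'M[C]_(n, m)) :
  (\dim (colspan B) <= m)%N.
Proof. by rewrite (leq_trans (dim_span _)) // size_map size_enum_ord. Qed.

Lemma colspan_row_mx (C : numClosedFieldType) n m1 m2
    (B1 : 'M[C]_(n, m1)) (B2 : 'M[C]_(n, m2)) :
  colspan (row_mx B1 B2) = (colspan B1 + colspan B2)%VS.
Proof.
apply/vspaceP => y; apply/colspanP/memv_addP => [[g ->]|].
  rewrite -[g]vsubmxK mul_row_col.
  by exists (B1 *m usubmx g); rewrite ?mem_colspan_mul //;
    exists (B2 *m dsubmx g); rewrite ?mem_colspan_mul.
move=> [_ /colspanP[g1 ->] [_ /colspanP[g2 ->] ->]].
by exists (col_mx g1 g2); rewrite mul_row_col.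
Qed.

Lemma colspan_mul (C : numClosedFieldType) n n' m (B : 'M[C]_(n', n))
    (X : 'M[C]_(n, m)) :
  (linfun (mulmx B : 'cV_n -> 'cV_n') @: colspan X)%VS = colspan (B *m X).
Proof.
apply/vspaceP => y; apply/memv_imgP/colspanP.
  by move=> [_ /colspanP[g ->] ->]; exists g; rewrite lfunE /= mulmxA.
move=> [g ->]; exists (X *m g); rewrite ?mem_colspan_mul //.
by rewrite lfunE /= mulmxA.
Qed.

Lemma perp_colspan (C : numClosedFieldType) n m (x : 'cV[C]_n)
    (P : 'M[C]_(n, m)) : perp x (colspan P) <-> P^t* *m x = 0.
Proof.
(* [dotmx] conjugates its second argument; taking a column of [P] for [z] then yields an entry of
   [P^t* *m x]. *)
have dotE (z : 'cV[C]_n) : dotmx x^T z^T = (z^t* *m x) 0 0.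
  by rewrite dotmxE !mxE; apply: eq_bigr => i _; rewrite !mxE mulrC.
split=> [xP|Px0 z /colspanP[g ->]]; last first.
  by rewrite dotE trmx_mul map_mxM -mulmxA Px0 mulmx0 mxE.
apply/colP => i.
have /xP : col i P \in colspan P by rewrite colE mem_colspan_mul.
rewrite dotE => eP; rewrite [RHS]mxE -eP !mxE.
by apply: eq_bigr => k _; rewrite !mxE.
Qed.

(** The flat index of an entry depends only on its offset and on the sizes of the blocks before its
    own, so appending a last block does not move it. *)
Lemma arnoldi_basis_widen (C : numClosedFieldType) n s
    (V : nat -> 'M[C]_(n, s)) j :
  arnoldi_basis V j.+1 *m extended_id C s j = arnoldi_basis V j.
Proof.
apply/matrixP => a b; rewrite /extended_id /pid_mx mxE.
pose b' : 'I_(\sum_(l < j.+1) s) :=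
  tagnat.Rank (p_ := fun=> s) (widen_ord (leqnSn j) (tagnat.sig1 b))
    (tagnat.sig2 b).
have b'E : b' = b :> nat.
  rewrite -[in RHS](tagnat.sig2K b) !tagnat.RankEsum; congr (_ + _)%N.
  (* The appended block has index [j], beyond the block of [b], so it adds nothing to the offset. *)
  by rewrite big_mkcond big_ord_recr /= ltnNge ltnW // addn0 -big_mkcond.
rewrite (bigD1 b') //= [X in _ + X]big1 => [|l lb']; last first.
  by rewrite [X in _ * X]mxE -b'E val_eqE (negPf lb') mulr0.
rewrite addr0 [X in _ * X]mxE b'E eqxx ltn_ord mulr1 !mxE.
by rewrite tagnat.Rank2K cast_ord_id tagnat.Rank1K.
Qed.

Lemma arnoldi_residualE (C : numClosedFieldType) n s (A : 'M[C]_n)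
    (V : nat -> 'M[C]_(n, s)) (H : nat -> nat -> 'M[C]_s) m l :
  arnoldi_residual A V H m l = A *m V m - \sum_(p < l) V p *m H p m.
Proof.
elim: l => [|l IH] /=; first by rewrite big_ord0 subr0.
by rewrite IH big_ord_recr /= opprD addrA.
Qed.

Section Arnoldi.
Variables (C : numClosedFieldType) (n s j : nat).
Variables (A : 'M[C]_n) (R : 'M[C]_(n, s)).
Variables (V : nat -> 'M[C]_(n, s)) (S0 : 'M[C]_s) (H : nat -> nat -> 'M[C]_s).
Hypothesis arnoldi : block_arnoldi A R j V S0 H.

Lemma block_arnoldi_column m : (m < j)%N ->
  A *m V m = \sum_(l < m.+2) V l *m H l m.
Proof.
move=> mj; have [+ _ _] := block_arnoldi_next arnoldi mj.
rewrite arnoldi_residualE => eW; rewrite big_ord_recr /= -eW.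
by rewrite addrC subrK.
Qed.

(** Stated for every [m <= j] because the induction on Krylov blocks applies it to shorter bases. *)
Lemma block_arnoldi_relation m : (m <= j)%N ->
  A *m arnoldi_basis V m = arnoldi_basis V m.+1 *m arnoldi_hessenberg H m.
Proof.
move=> mj; rewrite mul_mxrow mul_mxrow_mxblock; apply: eq_mxrow => p.
rewrite block_arnoldi_column ?(leq_trans _ mj) //.
(* As [p < m], the [p.+2] terms fit among [m.+1]; the added ones match the zero blocks below the
   subdiagonal. *)
rewrite (big_ord_widen m.+1 (fun l => V l *m H l p)) ?ltnS // big_mkcond /=.
by apply: eq_bigr => l _; rewrite ltnS; case: ifP; rewrite ?mulmx0.
Qed.

(** Each multiplication by [A] costs one more basis block, so the induction on [i] must leave [m]
    free. *)
Lemma krylov_block_factor i m : (i < m <= j)%N ->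
  exists X, A ^+ i *m R = arnoldi_basis V m *m X.
Proof.
elim: i m => [|i IH] [//|m] /andP[im mj].
  rewrite expr0 mul1mx; have [-> _ _] := block_arnoldi_start arnoldi.
  (* The starting factorization is [R = V 0 *m S0], so only the first block contributes. *)
  exists (\mxcol_(l < m.+1) if l == 0 then S0 else 0).
  rewrite mul_mxrow_mxcol big_ord_recl /= big1 ?addr0 // => l _.
  by rewrite mulmx0.
have [|X eX] := IH m; first by rewrite -ltnS im ltnW.
exists (arnoldi_hessenberg H m *m X).
by rewrite exprS -mulmxA eX !mulmxA (block_arnoldi_relation (ltnW mj)).
Qed.

Lemma block_krylov_colspan :
  \dim (block_krylov A R j) = (j * s)%N ->
  block_krylov A R j = colspan (arnoldi_basis V j).
Proof.
move=> dimK; apply/eqP; rewrite eqEdim dimK.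
apply/andP; split; last first.
  by rewrite (leq_trans (dim_colspan _)) // sum_nat_const card_ord.
apply/span_subvP => _ /allpairsP[[i c] /= [+ _ ->]].
rewrite mem_iota /= add0n => ij.
have [|X ->] := @krylov_block_factor i j; first by rewrite ij /=.
by rewrite colE -mulmxA mem_colspan_mul.
Qed.

End Arnoldi.

Theorem proposition7p1 (RR : realType) (n s j k : nat)
    (A : 'M[RR[i]]_n) (sigma : RR[i]) (R : 'M[RR[i]]_(n, s))
    (V : nat -> 'M[RR[i]]_(n, s)) (S0 : 'M[RR[i]]_s)
    (H : nat -> nat -> 'M[RR[i]]_s)
    (UU : {vspace 'cV[RR[i]]_n}) (U : 'M[RR[i]]_(n, k))
    (j_gt0 : (0 < j)%N)
    (unit_shift : A + sigma%:M \in unitmx)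
    (dim_krylov : \dim (block_krylov A R j) = (j * s)%N)
    (arnoldi : block_arnoldi A R j V S0 H)
    (nobreak : no_breakdown A j V H)
    (dim_UU : \dim UU = k)
    (span_UU : UU = colspan U) :
  let C := A *m U in
  let Vhat := row_mx U (arnoldi_basis V j) in
  let What := row_mx C (arnoldi_basis V j.+1) in
  let G := block_mx 1%:M 0
             0 (sigma *: extended_id RR[i] s j + arnoldi_hessenberg H j) in
  let M := row_mx (sigma *: U) 0 in
  let P := What *m G + M in
  forall (y : 'cV[RR[i]]_n) (mu : RR[i]),
    harmonic_ritz (A + sigma%:M) (block_krylov A R j + UU)%VS y mu <->
    exists g : 'cV[RR[i]]_(k + \sum_(m < j) s),
      y = (A + sigma%:M) *m Vhat *m g /\
      P^t* *m Vhat *m g = mu *: (P^t* *m P *m g).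
Proof.
move=> C Vhat What G M P y mu.
(* On the columns of [U], [C] supplies [A *m U] and [M] the shift; on the Arnoldi columns, both come
   from the lower right block of [G]. *)
have PE : P = (A + sigma%:M) *m Vhat.
  rewrite /P /What /G /M /Vhat mul_row_block !mulmx0 mulmx1 addr0 add0r.
  rewrite add_row_mx addr0 mul_mx_row !mulmxDl mulmxDr -scalemxAr.
  rewrite (arnoldi_basis_widen V) -(block_arnoldi_relation arnoldi (leqnn j)).
  by rewrite !mul_scalar_mx [X in row_mx _ X]addrC.
rewrite /harmonic_ritz span_UU (block_krylov_colspan arnoldi dim_krylov).
(* The summands are swapped because [Vhat] lists [U] first; the image space becomes [colspan P]. *)
rewrite [(_ + colspan U)%VS]addvC -colspan_row_mx colspan_mul -/Vhat -PE /=.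
rewrite perp_colspan.
have ritzE g : P^t* *m (invmx (A + sigma%:M) *m (P *m g) - mu *: (P *m g))
    = P^t* *m Vhat *m g - mu *: (P^t* *m P *m g).
  (* Only the [P] under [invmx] is expanded, so that the shifted matrix cancels there. *)
  by rewrite {2}PE -mulmxA mulKmx // mulmxBr -scalemxAr !mulmxA.
split=> [[/colspanP[g ->]]|[g [-> eig]]].
  by rewrite ritzE => /eqP; rewrite subr_eq0 => /eqP eig; exists g.
by split; [exact: mem_colspan_mul | rewrite ritzE eig subrr].
Qed.
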